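(* Let $N\ge 3$, $\varepsilon=1/N$, $\lambda\in\mathbb{R}$, and consider the functional $$F_\varepsilon(u)=\sum_{i=1}^{N}\frac{1}{|\log\varepsilon|}\log\Bigl(1+|\log\varepsilon|\frac{|u_i-u_{i-1}|^2}{\varepsilon}\Bigr)$$ on the set of $u=(u_0,\dots,u_N)\in\mathbb{R}^{N+1}$ with $u_0=0$ and $u_N=\lambda$. For such $u$ put $w_i=\sqrt{\frac{|\log\varepsilon|}{\varepsilon}}\,(u_i-u_{i-1})$, $i=1,\dots,N$. Then the local minimizers of $F_\varepsilon$ on this set are exactly the following: (a) the configuration with all $w_i$ equal, i.e. $u_i=\lambda i/N$; it is a local minimizer if and only if $|\lambda|<\frac{1}{\sqrt{\varepsilon|\log\varepsilon|}}$, and in that case $|w_i|<1$ for all $i$; (b) configurations with exactly one index $i$ such that $|w_i|>1$; these exist if and only if $|\lambda|>2\sqrt{\frac{1-\varepsilon}{|\log\varepsilon|}}$. In that case, for each choice of the index $i\in\{1,\dots,N\}$ there is exactly one such local minimizer; it satisfies $$u_i-u_{i-1}=\operatorname{sign}(\lambda)\left(\frac{|\lambda|}{2}+\sqrt{\frac{\lambda^2}{4}-\frac{1-\varepsilon}{|\log\varepsilon|}}\right),$$ and $u_j-u_{j-1}=\frac{\lambda-(u_i-u_{i-1})}{N-1}$ for all $j\ne i$. In particular, no local minimizer has two or more indices with $|w_i|>1$, and no local minimizer has an index with $|w_i|=1$.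
   Context: A local minimizer is meant with respect to the Euclidean topology on the finite-dimensional affine set $\{u\in\mathbb{R}^{N+1}: u_0=0,\ u_N=\lambda\}$. The value $1$ is the convexity threshold of $J(z)=\log(1+z^2)$, which is convex on $[-1,1]$ and concave on $[1,+\infty)$. *)

(* Defs.v *)
From HB Require Import structures.
From mathcomp Require Import all_boot all_order all_algebra.
From mathcomp Require Import all_classical all_reals all_analysis.

Set Implicit Arguments.
Unset Strict Implicit.
Unset Printing Implicit Defensive.

Import Order.TTheory GRing.Theory Num.Theory.
Import numFieldNormedType.Exports.

Local Open Scope classical_set_scope.
Local Open Scope ring_scope.

(* Local minimizer of f on A for the subspace topology that A inherits from T.
   For T = 'rV[R]_n the library topology is the one of the sup norm, which is
   the Euclidean topology. *)
Definition local_minimizer (R : realType) (T : topologicalType) (A : set T)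
    (f : T -> R) (x : T) : Prop :=
  A x /\ \forall y \near within A (nbhs x), f x <= f y.

(* A vector u = (u_0, ..., u_N) is a row vector of length N.+1.  Increments are
   indexed from 0: [increment u i] is u_(i+1) - u_i for 0 <= i < N. *)
Definition increment (R : realType) (N : nat) (u : 'rV[R]_N.+1) (i : 'I_N) : R :=
  u ord0 (lift ord0 i) - u ord0 (widen_ord (leqnSn N) i).

Definition boundary_set (R : realType) (N : nat) (lambda : R) :
    set 'rV[R]_N.+1 :=
  [set u | u ord0 ord0 = 0 /\ u ord0 ord_max = lambda].
Arguments boundary_set {R} N lambda.

Definition energy (R : realType) (N : nat) (eps : R) (u : 'rV[R]_N.+1) : R :=
  \sum_(i < N) (1 / `|ln eps| *
    ln (1 + `|ln eps| * (`|increment u i| ^+ 2 / eps))).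

Definition scaled_increment (R : realType) (N : nat) (eps : R)
    (u : 'rV[R]_N.+1) (i : 'I_N) : R :=
  Num.sqrt (`|ln eps| / eps) * increment u i.

Definition linear_config (R : realType) (N : nat) (lambda : R) : 'rV[R]_N.+1 :=
  \row_(i < N.+1) (lambda * (i : nat)%:R / N%:R).
Arguments linear_config {R} N lambda.

Definition jump_size (R : realType) (eps lambda : R) : R :=
  Num.sg lambda *
  (`|lambda| / 2 + Num.sqrt (lambda ^+ 2 / 4 - (1 - eps) / `|ln eps|)).

Definition has_jump_increments (R : realType) (N : nat) (eps lambda : R)
    (i : 'I_N) (u : 'rV[R]_N.+1) : Prop :=
  increment u i = jump_size eps lambda /\
  forall j : 'I_N, j != i ->
    increment u j = (lambda - increment u i) / (N%:R - 1).

(* Main.v *)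
Require Import Defs.
From HB Require Import structures.
From mathcomp Require Import all_boot all_order all_algebra.
From mathcomp Require Import all_classical all_reals all_analysis.
From mathcomp Require Import ring lra.

Set Implicit Arguments.
Unset Strict Implicit.
Unset Printing Implicit Defensive.

Import Order.TTheory GRing.Theory Num.Theory.
Import numFieldNormedType.Exports.

Local Open Scope classical_set_scope.
Local Open Scope ring_scope.

(** In the scaled increments [w] the energy is, up to a positive factor, the sum
    of [J (w i)] with [J z = ln (1 + z ^+ 2)], and the boundary conditions fix
    the sum [S] of the [w i].  Everything follows from the identity
      [J' x - J' y = 2 (x - y) (1 - x y) / ((1 + x^2) (1 + y^2))],
    which, through the mean value theorem ([transfer_sign]), gives the sign of
    the change of energy when an amount [n t] is added to one scaled increment
    with value [x] and taken in equal parts from [n] others with value [y]: it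
    is the sign of [t (x' - y') (1 - x' y')] for some intermediate [x'], [y'].

    Necessity.  Transferring between two increments shows that any two of them
    are equal or reciprocal ([stable_equal_or_reciprocal]), and that two equal
    ones lie in [-1, 1] ([stable_equal_le1]).  So either all are equal, or one
    value [x] with [1 < `|x|] stands against [N - 1] copies of [x^-1].
    Transferring between one increment and all the others gives the remaining
    restrictions.  If all values equal 1 or all equal -1, the energy along this
    path has a nonzero third derivative as soon as [N >= 3]
    ([stable_flat_lt1]).  Against a jump [x] it decreases in one direction
    whenever [x ^+ 2 <= N - 1], including the degenerate case of equality
    ([stable_jump_gt]).

    Sufficiency.  [J] lies above its tangents on [-1, 1], which settles the flat
    case ([stable_flat]) and, by Jensen, reduces the jump case to the path that
    moves all increments other than the jump together; there the sign above is
    nonnegative when [N - 1 < x ^+ 2] ([stable_jump]).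

    Thresholds.  For a jump [x + (N - 1) / x = S], so [x] is a root of a
    quadratic equation with product of roots [N - 1]; the condition
    [N - 1 < x ^+ 2] selects the root of larger modulus and forces the
    discriminant to be positive ([jump_equationP]). *)

(** * The potential and the sign of a transfer *)

Definition log_potential (R : realType) (z : R) : R := ln (1 + z ^+ 2).

Definition log_potential' (R : realType) (z : R) : R := 2 * z / (1 + z ^+ 2).

Lemma add1_sqr_gt0 (R : realType) (z : R) : 0 < 1 + z ^+ 2.
Proof. by rewrite ltr_wpDr ?sqr_ge0. Qed.

Lemma is_derive_log_potential (R : realType) (z : R) :
  is_derive z 1 (@log_potential R) (log_potential' z).
Proof.
have -> : @log_potential R = (@ln R) \o (fun x => 1 + x ^+ 2) by [].
have lnd := is_derive1_ln (add1_sqr_gt0 z).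
have pold : is_derive z 1 (fun x : R => 1 + x ^+ 2) (2 * z).
  apply: is_derive_eq; rewrite add0r /GRing.scale /=; ring.
rewrite /log_potential' mulrC.
exact: is_derive1_comp.
Qed.

Lemma log_potential'B (R : realType) (x y : R) :
  log_potential' x - log_potential' y =
  2 / ((1 + x ^+ 2) * (1 + y ^+ 2)) * ((x - y) * (1 - x * y)).
Proof.
rewrite /log_potential'; field.
by rewrite !gt_eqF ?add1_sqr_gt0.
Qed.

(** The argument [s] runs over [0, 1], so that one application of the mean value
    theorem treats both signs of the transferred amount [t]. *)
Lemma is_derive_transfer (R : realType) (x y n t s : R) :
  is_derive s 1 (fun r => log_potential (x + n * (r * t)) +
                          n * log_potential (y - r * t))
    (n * t * (log_potential' (x + n * (s * t)) - log_potential' (y - s * t))).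
Proof.
have dx : is_derive s 1 (fun r : R => x + n * (r * t)) (n * t).
  apply: is_derive_eq; rewrite add0r /GRing.scale /=; ring.
have dy : is_derive s 1 (fun r : R => y - r * t) (- t).
  apply: is_derive_eq; rewrite add0r /GRing.scale /=; ring.
have Dx := is_derive1_comp (g := fun r => x + n * (r * t))
  (is_derive_log_potential _) dx.
have Dy := is_derive1_comp (g := fun r => y - r * t)
  (is_derive_log_potential _) dy.
have D := is_deriveD Dx (is_deriveZ n Dy).
apply: is_derive_eq; rewrite /GRing.scale /=; ring.
Qed.

(** Mean value theorem along the path of [is_derive_transfer], with the positive
    factors of the derivative gathered in [k]. *)
Lemma transfer_sign (R : realType) (x y n t : R) : 0 < n ->
  exists s k : R, [/\ 0 < s < 1, 0 < k &
    log_potential (x + n * t) + n * log_potential (y - t) -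
      (log_potential x + n * log_potential y) =
    k * (t * ((x + n * (s * t) - (y - s * t)) *
              (1 - (x + n * (s * t)) * (y - s * t))))].
Proof.
move=> n0.
set f := fun r => log_potential (x + n * (r * t)) +
                  n * log_potential (y - r * t).
have df (s : R) : is_derive s 1 f (n * t * (log_potential' (x + n * (s * t)) -
                                       log_potential' (y - s * t))).
  exact: is_derive_transfer.
have cf : {within `[0, 1], continuous f}.
  apply: derivable_within_continuous => s _.
  exact: ex_derive.
have [s] := MVT ltr01 (fun s _ => df s) cf.
rewrite in_itv /= => s01.
rewrite /f !mul1r !mul0r !mulr0 addr0 subr0 subr0 mulr1 log_potential'B => ->.
set x' := x + _; set y' := y - _.
exists s, (n * (2 / ((1 + x' ^+ 2) * (1 + y' ^+ 2)))); split=> //; last first.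
  rewrite -/x' -/y'; ring.
by rewrite mulr_gt0 ?mulr_gt0 ?invr_gt0 ?mulr_gt0 ?add1_sqr_gt0.
Qed.

(** Convexity of the potential on [-1, 1]: the slope difference between two
    points [z], [m] of this interval has the sign of [z - m], as [z * m <= 1]. *)
Lemma log_potential_tangent (R : realType) (m x : R) : `|m| <= 1 -> `|x| <= 1 ->
  log_potential m + log_potential' m * (x - m) <= log_potential x.
Proof.
rewrite !ler_norml => /andP[m1 m2] /andP[x1 x2].
set f := fun r => log_potential (m + r * (x - m)).
have df (s : R) : is_derive s 1 f (log_potential' (m + s * (x - m)) * (x - m)).
  have dg : is_derive (s : R) 1 (fun r : R => m + r * (x - m)) (x - m).
    apply: is_derive_eq; rewrite add0r /GRing.scale /=; ring.
  exact: (is_derive1_comp (g := fun r => m + r * (x - m))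
    (is_derive_log_potential _) dg).
have cf : {within `[0, 1], continuous f}.
  by apply: derivable_within_continuous => s _; exact: ex_derive.
have [s] := MVT ltr01 (fun s _ => df s) cf.
rewrite in_itv /= => /andP[s0 s1].
rewrite /f mul1r mul0r addr0 subr0 mulr1 [m + (x - m)]addrC subrK.
set z := m + s * (x - m) => Ef.
have zP : -1 <= z <= 1 by rewrite /z; nra.
have : 0 <= (log_potential' z - log_potential' m) * (x - m).
  rewrite log_potential'B -[leRHS]mulrA; apply: mulr_ge0.
    by rewrite divr_ge0 // mulr_ge0 // ltW // add1_sqr_gt0.
  have -> : z - m = s * (x - m) by rewrite /z; ring.
  have -> : s * (x - m) * (1 - z * m) * (x - m) =
            s * (x - m) ^+ 2 * (1 - z * m) by ring.
  rewrite mulr_ge0 //; first by rewrite mulr_ge0 ?sqr_ge0 // ltW.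
  move/andP: zP => [z1 z2]; nra.
rewrite mulrBl -Ef; lra.
Qed.

(** * Minimality under a fixed sum *)

(** Local minimality of the total potential among families with the same sum;
    this is the problem for local minimizers rewritten in the scaled
    increments. *)
Definition stable (R : realType) (N : nat) (w : 'I_N -> R) : Prop :=
  exists2 d : R, 0 < d & forall w' : 'I_N -> R,
    \sum_i w' i = \sum_i w i -> (forall i, `|w' i - w i| < d) ->
    \sum_i log_potential (w i) <= \sum_i log_potential (w' i).

(** The tangent at [a] has total contribution zero under a fixed sum, and all
    nearby values stay in [-1, 1]. *)
Lemma stable_flat (R : realType) (N : nat) (w : 'I_N -> R) (a : R) :
  `|a| < 1 -> (forall i, w i = a) -> stable w.
Proof.
move=> a1 wa; exists (1 - `|a|); first by rewrite subr_gt0.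
move=> w' sw w'a.
have <- : \sum_i (log_potential a + log_potential' a * (w' i - w i)) =
    \sum_i log_potential (w i).
  rewrite big_split /= -mulr_sumr sumrB sw subrr mulr0 addr0.
  by apply: eq_bigr => i _; rewrite wa.
apply: ler_sum => i _.
rewrite wa; apply: log_potential_tangent; first exact: ltW.
have := w'a i; rewrite wa => h.
have := ler_normD (w' i - a) a; rewrite subrK; lra.
Qed.

Lemma sum_other_const (R : realType) (N : nat) (i : 'I_N) (c : R) :
  \sum_(j < N | j != i) c = (N%:R - 1) * c.
Proof.
have N0 : (0 < N)%N by apply: leq_ltn_trans (ltn_ord i).
by rewrite sumr_const cardC1 card_ord -subn1 mulrnBr ?mulrBl ?mul1r ?mulr_natl.
Qed.

(** Given a nearby competitor [w'], write its jump as [x + n * t] with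
    [n = N - 1]; the mean of the others is then [y - t].  Jensen on [-1, 1]
    replaces the others by their mean, and the competitor lies on the transfer
    path, where [x * y = 1] turns the sign of [transfer_sign] into that of
    [(x - y + (n + 1) c) * (x - n y + n c)] with [c] small. *)
Lemma stable_jump (R : realType) (N : nat) (w : 'I_N -> R) (i : 'I_N) :
  (1 < N)%N -> N%:R - 1 < w i ^+ 2 -> (forall j, j != i -> w j * w i = 1) ->
  stable w.
Proof.
move=> N1; set x := w i; set n : R := N%:R - 1 => nx xy.
have n1 : 1 <= n.
  rewrite /n; have : 2%:R <= N%:R :> R by rewrite ler_nat.
  lra.
have x0 : x != 0 by apply/eqP => x0; move: nx; rewrite x0; lra.
set y := x^-1.
have wy j : j != i -> w j = y.
  by move=> ji; apply: (mulIf x0); rewrite xy // mulVf.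
have xyE : x * y = 1 by rewrite divff.
have ax1 : 1 < `|x|.
  rewrite -(@ltr_pXn2r _ 2) ?nnegrE // expr1n real_normK ?num_real //; lra.
have ay1 : `|y| < 1 by rewrite normfV invf_lt1 // normr_gt0.
pose d1 := (x ^+ 2 - n) / ((n + 1) * `|x|).
have nx0 : 0 < (n + 1) * `|x| by rewrite mulr_gt0 //; lra.
have d10 : 0 < d1 by rewrite divr_gt0 // subr_gt0.
(* Below [1 - `|y|] the small increments stay in [-1, 1]; below [d1] the two
   factors of the transfer keep the sign that they have at [c = 0]. *)
exists (Num.min d1 (1 - `|y|)).
  by rewrite lt_min d10 subr_gt0.
move=> w'; rewrite [in X in X -> _](bigD1 i) //= [in RHS](bigD1 i) //=.
move=> sw w'w.
have sumi (c : R) : \sum_(j < N | j != i) c = n * c.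
  exact: sum_other_const.
rewrite (bigD1 i) //= [leRHS](bigD1 i) //=.
have -> : \sum_(j < N | j != i) log_potential (w j) = n * log_potential y.
  by rewrite -sumi; apply: eq_bigr => j ji; rewrite wy.
have swy : \sum_(j < N | j != i) w j = n * y.
  by rewrite -sumi; apply: eq_bigr => j ji; rewrite wy.
pose t := (w' i - x) / n.
have n0 : n != 0 by rewrite gt_eqF //; lra.
have w'i : w' i = x + n * t by rewrite /t mulrC divfK // addrC subrK.
have sw' : \sum_(j < N | j != i) w' j = n * (y - t).
  by move: sw; rewrite swy w'i -/x; lra.
have td : `|t| < Num.min d1 (1 - `|y|).
  apply: le_lt_trans (w'w i).
  rewrite w'i -/x [x + _]addrC addrK (normrM n) (ger0_norm (_ : 0 <= n)); last by lra.
  by rewrite ler_peMl.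
move: (td); rewrite lt_min => /andP[td1 td2].
have m1 : `|y - t| <= 1.
  by have := ler_normB y t; lra.
have jensen : n * log_potential (y - t) <=
    \sum_(j < N | j != i) log_potential (w' j).
  have <- : \sum_(j < N | j != i) (log_potential (y - t) +
      log_potential' (y - t) * (w' j - (y - t))) = n * log_potential (y - t).
    by rewrite big_split /= -mulr_sumr sumrB sw' !sumi subrr mulr0 addr0.
  apply: ler_sum => j ji.
  apply: log_potential_tangent => //.
  have := w'w j; rewrite wy // lt_min => /andP[_ h].
  have := ler_normD (w' j - y) y; rewrite subrK; lra.
rewrite -/x w'i; apply: le_trans (_ : _ <= log_potential (x + n * t) +
  n * log_potential (y - t)) _; last by rewrite lerD2l.
have npos : 0 < n by lra.
have [s [k [/andP[s0 s1] k0 E]]] := transfer_sign x y t npos.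
rewrite -subr_ge0 E; apply: mulr_ge0; first exact: ltW.
set c := s * t.
have cd : `|c| < d1.
  apply: le_lt_trans td1; rewrite /c normrM gtr0_norm //.
  by rewrite ler_piMl // ltW.
have xc : `|(n + 1) * x * c| < x ^+ 2 - n.
  rewrite (normrM (_ * x)) (normrM _ x) (ger0_norm (_ : 0 <= n + 1)); last by lra.
  by rewrite mulrC -ltr_pdivlMr.
have -> : t * ((x + n * c - (y - c)) * (1 - (x + n * c) * (y - c))) =
  s * t ^+ 2 * ((x - y + (n + 1) * c) * (x - n * y + n * c)).
  have -> : 1 - (x + n * c) * (y - c) = c * (x - n * y + n * c).
    by rewrite -{1}xyE; ring.
  by rewrite /c; ring.
rewrite mulr_ge0 //; first by rewrite mulr_ge0 ?sqr_ge0 // ltW.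
have xA : x * (x - y + (n + 1) * c) = x ^+ 2 - 1 + (n + 1) * x * c by lra.
have xB : x * (x - n * y + n * c) = x ^+ 2 - n + n * x * c.
  have -> : x * (x - n * y + n * c) = x ^+ 2 - n * (x * y) + n * x * c by ring.
  by rewrite xyE mulr1.
(* Multiplying each factor by [x] avoids distinguishing the sign of [x]. *)
rewrite -(@pmulr_rge0 _ (x * x)); last by rewrite -expr2 exprn_even_gt0.
rewrite mulrACA xA xB.
have xc' : `|n * x * c| < x ^+ 2 - n.
  apply: le_lt_trans xc; rewrite -!mulrA !(normrM _ (x * c)).
  apply: ler_wpM2r => //; rewrite !ger0_norm; lra.
move: xc xc'; rewrite !ltr_norml => /andP[h1 h2] /andP[h3 h4].
apply: mulr_ge0; lra.
Qed.

(** * Restrictions on stable families *)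

(** The necessary condition from which all the others are drawn: in each
    direction [sigma] the sign of [transfer_sign] is nonnegative for arbitrarily
    small [tau].  A family is shown not to be stable by exhibiting a [sigma] for
    which the expression is negative for all small [tau > 0]. *)
Lemma stable_transfer (R : realType) (N : nat) (w : 'I_N -> R) (i : 'I_N)
    (P : {set 'I_N}) (y sigma delta : R) :
  stable w -> i \notin P -> (0 < #|P|)%N -> (forall j, j \in P -> w j = y) ->
  0 < delta ->
  exists2 tau : R, 0 < tau < delta &
    let n : R := #|P|%:R in
    0 <= sigma * ((w i - y + (n + 1) * (sigma * tau)) *
      (1 - (w i + n * (sigma * tau)) * (y - sigma * tau))).
Proof.
move=> [d d0 wmin] iP P0 wP delta0; set n : R := #|P|%:R.
have n0 : 0 < n by rewrite ltr0n.
have s0 : 0 < (n + 1) * (`|sigma| + 1).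
  by rewrite mulr_gt0 ?ltr_wpDl // ltW.
(* With this [r] every increment moves by less than [d]; halving gives
   [r < delta]. *)
pose r := Num.min delta (d / ((n + 1) * (`|sigma| + 1))) / 2.
have r0 : 0 < r by rewrite divr_gt0 // lt_min delta0 divr_gt0.
have [rdelta rd] : r < delta /\ r * ((n + 1) * (`|sigma| + 1)) < d.
  have h : r < Num.min delta (d / ((n + 1) * (`|sigma| + 1))).
    by rewrite /r ltr_pdivrMr // ltr_pMr ?ltr1n // lt_min delta0 divr_gt0.
  by move: h; rewrite lt_min ltr_pdivlMr // => /andP[].
clearbody r; set t := sigma * r.
have small a : `|a| <= n + 1 -> `|a * t| < d.
  move=> ha; apply: le_lt_trans rd.
  rewrite /t !normrM (gtr0_norm r0).
  rewrite mulrA mulrC ler_pM2l //.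
  by rewrite ler_pM // ?ler_wpDr.
pose w' k := if k == i then w i + n * t else if k \in P then w k - t else w k.
have split_sum (f g : 'I_N -> R) : (forall k, k != i -> k \notin P -> f k = g k) ->
    \sum_k f k - \sum_k g k = f i - g i + \sum_(k in P) (f k - g k).
  move=> fg; rewrite -sumrB (bigD1 i) //=; congr (_ + _).
  rewrite [LHS](bigID (mem P)) /= [X in _ + X]big1 ?addr0; last first.
    by move=> k /andP[ki kP]; rewrite fg // subrr.
  by apply: eq_bigl => k; case: eqVneq => [->|]; rewrite ?(negPf iP).
have w'i : w' i = w i + n * t by rewrite /w' eqxx.
have w'P k : k \in P -> w' k = y - t.
  move=> kP; rewrite /w' kP (wP _ kP); case: (eqVneq k i) => // ki.
  by rewrite -ki kP in iP.
have w'0 : forall k, k != i -> k \notin P -> w' k = w k.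
  by move=> k; rewrite /w' => /negPf -> /negPf ->.
have sumw' : \sum_k w' k = \sum_k w k.
  apply/eqP; rewrite -subr_eq0 split_sum // w'i.
  rewrite (eq_bigr (fun=> - t)); last first.
    by move=> k kP; rewrite w'P // (wP _ kP); ring.
  rewrite sumr_const -mulr_natl -/n; apply/eqP; ring.
have w'w k : `|w' k - w k| < d.
  rewrite /w'; have [->|_] := eqVneq k i.
    rewrite addrC addKr small // ger0_norm ?ltW //; lra.
  case: ifP => _; last by rewrite subrr normr0.
  have -> : w k - t - w k = -1 * t by ring.
  rewrite small // normrN1; lra.
have := wmin w' sumw' w'w.
rewrite -subr_ge0 split_sum; last by move=> k ki kP; rewrite w'0.
rewrite w'i (eq_bigr (fun=> log_potential (y - t) - log_potential y)); last first.
  by move=> k kP; rewrite w'P // (wP _ kP).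
rewrite sumr_const -mulr_natl -/n.
have [s [k [/andP[s0' s1] k0 E]]] := transfer_sign (w i) y t n0.
have -> : log_potential (w i + n * t) - log_potential (w i) +
    n * (log_potential (y - t) - log_potential y) =
  log_potential (w i + n * t) + n * log_potential (y - t) -
    (log_potential (w i) + n * log_potential y) by ring.
rewrite E pmulr_rge0 // => pos.
exists (s * r); first by apply/andP; split; nra.
rewrite /=; move: pos; rewrite /t.
have -> : s * (sigma * r) = sigma * (s * r) by ring.
set c := sigma * (s * r).
rewrite -mulrA mulrCA pmulr_rge0 // => pos.
have -> : w i - y + (n + 1) * c = w i + n * c - (y - c) by ring.
by [].
Qed.

(** Criticality: otherwise [q = (x - y) (1 - x y)] is nonzero, and a transfer in
    the direction [- q] decreases the energy at first order. *)
Lemma stable_equal_or_reciprocal (R : realType) (N : nat) (w : 'I_N -> R) (i j : 'I_N) :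
  stable w -> i != j -> w i = w j \/ w i * w j = 1.
Proof.
move=> st ij; set x := w i; set y := w j.
have [->|xy] := eqVneq x y; first by left.
right; apply/eqP; rewrite -[_ == _]negbK; apply/negP => xy1.
pose a := x - y; pose p := 1 - x * y; pose q := a * p.
have q0 : q != 0 by rewrite mulf_neq0 // subr_eq0 // eq_sym.
have q2 : 0 < q ^+ 2 by rewrite exprn_even_gt0.
(* [K - 1] bounds the sum of the moduli of the nonconstant coefficients of the
   cubic in [tau] that appears below after factoring out [- q ^+ 2]. *)
pose K := 1 + a ^+ 2 + 2 * `|p| + 3 * `|q * a| + 2 * q ^+ 2.
have K1 : 1 <= K.
  rewrite /K; have := normr_ge0 p; have := normr_ge0 (q * a).
  have := sqr_ge0 a; lra.
have iP : i \notin [set j]%SET by rewrite finset.in_set1.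
have Pj k : k \in [set j]%SET -> w k = y by rewrite finset.in_set1 => /eqP ->.
have := stable_transfer (- q) st iP _ Pj (_ : 0 < K^-1).
rewrite cards1 invr_gt0 => /(_ isT (lt_le_trans ltr01 K1)) [tau /andP[t0 tK]] /=.
have tK1 : tau * K < 1 by rewrite -ltr_pdivlMr ?div1r // (lt_le_trans ltr01).
have t1 : tau < 1 by nra.
rewrite -/x leNgt => /negP; apply.
have -> : - q * ((x - y + (1 + 1) * (- q * tau)) *
     (1 - (x + 1 * (- q * tau)) * (y - - q * tau))) =
  - (q ^+ 2 * (1 - tau * (a ^+ 2 + 2 * p) + tau ^+ 2 * (3 * (q * a))
       - tau ^+ 3 * (2 * q ^+ 2))).
  by rewrite /q /a /p; ring.
rewrite oppr_lt0 mulr_gt0 //.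
have pn := ler_norm p; have qan := lerNnormlW (lexx `|q * a|).
have u2 : tau ^+ 2 <= tau by rewrite expr2; nra.
have u3 : tau ^+ 3 <= tau by rewrite exprS; nra.
have u20 := sqr_ge0 tau.
have h1 : tau * p <= tau * `|p| by rewrite ler_wpM2l // ltW.
have h2 : - (tau * `|q * a|) <= tau ^+ 2 * (q * a).
  have : tau ^+ 2 * - (q * a) <= tau * `|q * a|.
    have := normr_ge0 (q * a); have : - (q * a) <= `|q * a| by lra.
    nra.
  lra.
have h3 : tau ^+ 3 * q ^+ 2 <= tau * q ^+ 2 by rewrite ler_wpM2r // ltW.
move: tK1; rewrite /K; lra.
Qed.

(** Where the potential is strictly concave, separating two equal increments
    decreases the energy. *)
Lemma stable_equal_le1 (R : realType) (N : nat) (w : 'I_N -> R) (i j : 'I_N) :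
  stable w -> i != j -> w i = w j -> `|w i| <= 1.
Proof.
move=> st ij wij; rewrite leNgt; apply/negP => w1.
have iP : i \notin [set j]%SET by rewrite finset.in_set1.
have Pj k : k \in [set j]%SET -> w k = w i by rewrite finset.in_set1 => /eqP ->.
have w21 : 0 < w i ^+ 2 - 1.
  by rewrite subr_gt0 -(real_normK (num_real _)) exprn_egt1.
pose delta : R := Num.min 1 (w i ^+ 2 - 1).
have delta0 : 0 < delta by rewrite lt_min ltr01.
have [] := stable_transfer 1 st iP _ Pj delta0; first by rewrite cards1.
rewrite cards1 => tau; rewrite lt_min => /and3P[t0 t1 tw] /=.
rewrite leNgt => /negP; apply.
set x := w i in w21 tw *; have -> : 1 * ((x - x + (1 + 1) * (1 * tau)) *
  (1 - (x + 1 * (1 * tau)) * (x - 1 * tau))) =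
  - (2 * tau * (x ^+ 2 - 1 - tau ^+ 2)) by ring.
rewrite oppr_lt0 mulr_gt0 ?mulr_gt0 //; nra.
Qed.

(** At [a = 1] or [a = -1] second derivatives vanish, and exchanges between two
    increments only see a quartic term of the good sign.  Moving one increment
    against the [N - 1] others leaves a cubic term, with factor [N - 2]. *)
Lemma stable_flat_lt1 (R : realType) (N : nat) (w : 'I_N -> R) (a : R) :
  (3 <= N)%N -> stable w -> (forall i, w i = a) -> `|a| < 1.
Proof.
move=> N3 st wa.
have N0 : (0 < N)%N by apply: leq_trans N3.
have N1 : (1 < N)%N by apply: leq_trans N3.
pose i := Ordinal N0; pose j := Ordinal N1.
have a1 : `|a| <= 1 by rewrite -(wa i); apply: (@stable_equal_le1 _ _ _ i j); rewrite ?wa.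
rewrite lt_neqAle a1 andbT; apply/eqP => aE.
have a2 : a ^+ 2 = 1 by rewrite -(real_normK (num_real _)) aE expr1n.
have iP : i \notin [set~ i]%SET by rewrite !inE eqxx.
have cP : #|[set~ i]%SET| = N.-1 by rewrite cardsC1 card_ord.
have d0 : 0 < 2^-1 :> R by rewrite invr_gt0.
have [|tau] := stable_transfer a st iP _ (fun k _ => wa k) d0.
  by rewrite cP -subn1 subn_gt0.
rewrite cP wa; set n : R := N.-1%:R => /andP[t0 t1] /=.
have n2 : 2 <= n by rewrite /n ler_nat -ltnS prednK.
rewrite leNgt => /negP; apply.
have -> : a * ((a - a + (n + 1) * (a * tau)) *
    (1 - (a + n * (a * tau)) * (a - a * tau))) =
  a ^+ 2 * (n + 1) * tau * (1 - a ^+ 2 * ((1 + n * tau) * (1 - tau))) by ring.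
rewrite a2 !mul1r.
have -> : (n + 1) * tau * (1 - (1 + n * tau) * (1 - tau)) =
  - ((n + 1) * tau ^+ 2 * (n - 1 - n * tau)) by ring.
rewrite oppr_lt0 mulr_gt0 ?mulr_gt0 ?exprn_gt0 //; first lra.
nra.
Qed.

(** If [x ^+ 2 <= N - 1], moving the jump towards 0 decreases the energy.  This
    direction also works at equality, where the quadratic term vanishes and the
    cubic one decides. *)
Lemma stable_jump_gt (R : realType) (N : nat) (w : 'I_N -> R) (i : 'I_N) :
  (1 < N)%N -> stable w -> 1 < w i ^+ 2 ->
  (forall j, j != i -> w j * w i = 1) -> N%:R - 1 < w i ^+ 2.
Proof.
move=> N1 st x1 xy; rewrite ltNge; apply/negP => xn.
set x := w i in x1 xy xn *.
have x0 : x != 0 by apply/eqP => x0; move: x1; rewrite x0; lra.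
set y := x^-1.
have xyE : x * y = 1 by rewrite divff.
have iP : i \notin [set~ i]%SET by rewrite !inE eqxx.
have wy j : j \in [set~ i]%SET -> w j = y.
  by rewrite !inE => ji; apply: (mulIf x0); rewrite xy // mulVf.
have cP : #|[set~ i]%SET| = N.-1 by rewrite cardsC1 card_ord.
have nE : N.-1%:R = N%:R - 1 :> R by rewrite -subn1 natrB // ltnW.
set n : R := N%:R - 1 in xn nE *.
have nx0 : 0 < (n + 1) * x ^+ 2 by rewrite mulr_gt0 //; lra.
have d0 : 0 < (x ^+ 2 - 1) / ((n + 1) * x ^+ 2).
  by rewrite divr_gt0 // subr_gt0.
have [|tau] := stable_transfer (- x) st iP _ wy d0.
  by rewrite cP -subn1 subn_gt0.
rewrite cP nE ltr_pdivlMr // => /andP[t0 t1] /=.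
rewrite -/x leNgt => /negP; apply.
have -> : - x * ((x - y + (n + 1) * (- x * tau)) *
    (1 - (x + n * (- x * tau)) * (y - - x * tau))) =
  - ((x ^+ 2 - x * y - tau * ((n + 1) * x ^+ 2)) *
     (1 - x * y + tau * (n * (x * y) - x ^+ 2 + n * x ^+ 2 * tau))) by ring.
rewrite xyE mulr1 subrr add0r oppr_lt0 mulr_gt0 ?subr_gt0 // mulr_gt0 //.
by rewrite ltr_wpDl ?subr_ge0 // pmulr_lgt0 // pmulr_lgt0; lra.
Qed.

(** A value outside [-1, 1] cannot be repeated, so all others are its inverse; if
    there is none, reciprocal values in [-1, 1] are equal. *)
Lemma stableP (R : realType) (N : nat) (w : 'I_N -> R) : (3 <= N)%N ->
  stable w <->
  (exists2 a, `|a| < 1 & forall i, w i = a) \/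
  (exists2 i, N%:R - 1 < w i ^+ 2 & forall j, j != i -> w j * w i = 1).
Proof.
move=> N3; have N1 : (1 < N)%N by apply: leq_trans N3.
split=> [st|[[a a1 wa]|[i xn xy]]]; [|exact: stable_flat wa|exact: stable_jump xy].
have [[i x1]|flat] := pselect (exists i, 1 < `|w i|).
  right; have x2 : 1 < w i ^+ 2.
    by rewrite -(real_normK (num_real _)) exprn_egt1.
  have xy j : j != i -> w j * w i = 1.
    move=> ji; have [wji|//] := stable_equal_or_reciprocal st ji.
    by have := stable_equal_le1 st ji wji; rewrite wji leNgt x1.
  by exists i => //; apply: stable_jump_gt.
left; have le1 i : `|w i| <= 1.
  by rewrite leNgt; apply/negP => x1; apply: flat; exists i.
pose o : 'I_N := Ordinal (ltnW N1).
have wo i : w i = w o.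
  have [->//|io] := eqVneq i o.
  have [//|wio] := stable_equal_or_reciprocal st io.
  (* reciprocal numbers in [-1, 1] are equal *)
  have : (w i - w o) ^+ 2 <= 0.
    have sq k : w k ^+ 2 <= 1.
      by rewrite -(real_normK (num_real _)) expr_le1.
    have := sq i; have := sq o; rewrite sqrrB wio; lra.
  by rewrite real_exprn_even_le0 ?num_real //= subr_eq0 => /eqP.
exists (w o) => //; exact: stable_flat_lt1 N3 st wo.
Qed.

(** * Local minimizers in terms of increments *)

(** Inverse of [increment] on vectors that start at 0. *)
Definition of_increments (R : realType) (N : nat) (g : 'I_N -> R) : 'rV[R]_N.+1 :=
  \row_k \sum_(i < N | (i < k)%N) g i.

Lemma of_increments0 (R : realType) (N : nat) (g : 'I_N -> R) :
  of_increments g ord0 ord0 = 0.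
Proof. by rewrite mxE big_pred0. Qed.

Lemma of_increments_max (R : realType) (N : nat) (g : 'I_N -> R) :
  of_increments g ord0 ord_max = \sum_i g i.
Proof. by rewrite mxE; apply: eq_bigl => i; rewrite ltn_ord. Qed.

Lemma of_incrementsK (R : realType) (N : nat) (g : 'I_N -> R) (i : 'I_N) :
  increment (of_increments g) i = g i.
Proof.
rewrite /increment !mxE (bigD1 i) /=; last by rewrite /bump.
rewrite (eq_bigl (fun j : 'I_N => (j < i)%N)) ?addrK //.
by move=> j; rewrite /bump /= add1n ltnS ltn_neqAle andbC.
Qed.

Lemma of_increments_increment (R : realType) (N : nat) (u : 'rV[R]_N.+1) :
  u ord0 ord0 = 0 -> u = of_increments (increment u).
Proof.
move=> u0; apply/rowP => -[k kN]; rewrite !mxE /=.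
elim: k kN => [|k IH] kN.
  by rewrite big_pred0 // -u0; congr (u _ _); apply: val_inj.
pose i := Ordinal (kN : (k < N)%N).
have uk := IH (ltnW kN); rewrite (bigD1 i) /= ?ltnS //.
rewrite (eq_bigl (fun j : 'I_N => (j < k)%N)); last first.
  by move=> j; rewrite ltnS [RHS]ltn_neqAle andbC.
rewrite -uk /increment.
have -> : lift ord0 i = Ordinal kN by apply: val_inj.
have -> : widen_ord (leqnSn N) i = Ordinal (ltnW kN) by apply: val_inj.
by rewrite subrK.
Qed.

Lemma sum_increment (R : realType) (N : nat) (lambda : R) (u : 'rV[R]_N.+1) :
  boundary_set N lambda u -> \sum_i increment u i = lambda.
Proof.
by move=> [u0 uN]; rewrite -of_increments_max -of_increments_increment.
Qed.

Lemma boundary_set_of_increments (R : realType) (N : nat) (g : 'I_N -> R) :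
  boundary_set N (\sum_i g i) (of_increments g).
Proof. by split; [exact: of_increments0|exact: of_increments_max]. Qed.

Lemma boundary_set_inj (R : realType) (N : nat) (lambda : R)
    (u v : 'rV[R]_N.+1) :
  boundary_set N lambda u -> boundary_set N lambda v ->
  (forall i, increment u i = increment v i) -> u = v.
Proof.
move=> [u0 _] [v0 _] uv.
rewrite (of_increments_increment u0) (of_increments_increment v0).
by apply/rowP => k; rewrite !mxE; apply: eq_bigr.
Qed.

Lemma energyE (R : realType) (N : nat) (eps : R) (u : 'rV[R]_N.+1) :
  0 < eps ->
  energy eps u =
  1 / `|ln eps| * \sum_i log_potential (scaled_increment eps u i).
Proof.
move=> eps0; rewrite mulr_sumr; apply: eq_bigr => i _.
rewrite /log_potential /scaled_increment exprMn sqr_sqrtr.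
  by congr (_ * ln (1 + _)); rewrite real_normK ?num_real //; ring.
by rewrite divr_ge0 // ltW.
Qed.

(** The sup-norm balls around [u] and the boxes around its scaled increments are
    comparable: an increment is a difference of two coordinates, and a
    coordinate is a sum of at most [N] increments. *)
Lemma local_minimizerP (R : realType) (N : nat) (eps lambda : R)
    (u : 'rV[R]_N.+1) : 0 < eps < 1 ->
  local_minimizer (boundary_set N lambda) (energy eps) u <->
  boundary_set N lambda u /\ stable (scaled_increment eps u).
Proof.
move=> /andP[eps0 eps1].
have L0 : 0 < `|ln eps| by rewrite normr_gt0 lt_eqF // ln_lt0 // eps0.
pose k := Num.sqrt (`|ln eps| / eps).
have k0 : 0 < k by rewrite sqrtr_gt0 divr_gt0.
have wE v i : scaled_increment eps v i = k * increment v i by [].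
have energy_le v v' : (energy eps v <= energy eps v') =
    (\sum_i log_potential (scaled_increment eps v i) <=
     \sum_i log_potential (scaled_increment eps v' i)).
  by rewrite !energyE // ler_pM2l // divr_gt0.
split=> -[Au].
- move=> /nbhs_ballP[e /= e0 umin]; split=> //.
  exists (e * k / N.+1%:R); first by rewrite divr_gt0 ?mulr_gt0 ?ltr0n.
  move=> w' sumw' w'w.
  pose v := of_increments (fun i => w' i / k).
  have wv i : scaled_increment eps v i = w' i.
    by rewrite wE of_incrementsK mulrC divfK // gt_eqF.
  have Av : boundary_set N lambda v.
    have -> : lambda = \sum_i w' i / k.
      rewrite -mulr_suml sumw' -mulr_sumr (sum_increment Au) mulrC.
      by rewrite -/k mulKf // gt_eqF.
    exact: boundary_set_of_increments.
  suff : energy eps u <= energy eps v.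
    by rewrite energy_le; under [leRHS]eq_bigr do rewrite wv.
  apply: umin => //; split=> // i j; rewrite ord1.
  rewrite /ball /= (of_increments_increment Au.1) !mxE -sumrB.
  apply: le_lt_trans (ler_norm_sum _ _ _) _.
  apply: le_lt_trans (_ : _ <= \sum_(i < N) e / N.+1%:R) _.
    rewrite big_mkcond /=; apply: ler_sum => l _; case: ifP => _; last first.
      by rewrite divr_ge0 // ltW.
    have -> : increment u l - w' l / k = - ((w' l - k * increment u l) / k).
      by field; rewrite gt_eqF.
    rewrite normrN normrM normfV (gtr0_norm k0) ler_pdivrMr // mulrAC -wE.
    exact/ltW.
  rewrite sumr_const card_ord -[_ *+ N]mulr_natr mulrAC ltr_pdivrMr ?ltr0n //.
  by rewrite ltr_pM2l // ltr_nat.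
- move=> [d d0 st]; split=> //.
  apply/nbhs_ballP; exists (d / (2 * k)) => /=.
    by rewrite divr_gt0 ?mulr_gt0.
  move=> v [_ uv] Av /=; rewrite energy_le; apply: st => [|i].
    by rewrite -!mulr_sumr !(sum_increment (lambda := lambda)).
  rewrite !wE -mulrBr normrM gtr0_norm // mulrC -ltr_pdivlMr //.
  have h j : `|u ord0 j - v ord0 j| < d / (2 * k) by exact: uv.
  have -> : increment v i - increment u i =
      (u ord0 (widen_ord (leqnSn N) i) - v ord0 (widen_ord (leqnSn N) i)) -
      (u ord0 (lift ord0 i) - v ord0 (lift ord0 i)).
    by rewrite /increment; ring.
  apply: le_lt_trans (ler_normB _ _) _.
  have -> : d / k = d / (2 * k) + d / (2 * k).
    by field; rewrite gt_eqF.
  by rewrite ltrD.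
Qed.

(** * Thresholds *)

(** The roots of [X ^+ 2 - lambda X + kappa] have product [kappa], so the
    condition [kappa < x ^+ 2] says that [x] has the strictly larger modulus of
    the two; this root has the sign of [lambda]. *)
Lemma jump_equationP (R : realType) (kappa lambda x : R) : 0 < kappa ->
  (x * (lambda - x) = kappa /\ kappa < x ^+ 2) <->
  (2 * Num.sqrt kappa < `|lambda| /\
   x = Num.sg lambda * (`|lambda| / 2 + Num.sqrt (lambda ^+ 2 / 4 - kappa))).
Proof.
move=> kappa0.
have thrE : (2 * Num.sqrt kappa < `|lambda|) = (0 < lambda ^+ 2 / 4 - kappa).
  have sk : Num.sqrt kappa ^+ 2 = kappa by rewrite sqr_sqrtr // ltW.
  rewrite -(@ltr_pXn2r _ 2) ?nnegrE ?mulr_ge0 ?sqrtr_ge0 //.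
  rewrite exprMn sk real_normK ?num_real //.
  by apply/idP/idP => h; lra.
rewrite thrE; split.
- move=> [eqx xk].
  have x0 : x != 0 by apply/eqP => x0; move: xk; rewrite x0 expr0n /= ltNge ltW.
  pose y := lambda - x.
  have lE : lambda = x + y by rewrite /y; ring.
  have xy0 : 0 < x * y by rewrite eqx.
  have y2 : y ^+ 2 < x * y.
    have : y * y * (x ^+ 2) < (x * y) * (x ^+ 2).
      have -> : y * y * x ^+ 2 = (x * y) * (x * y) by ring.
      by rewrite ltr_pM2l // [x * y]eqx.
    by rewrite ltr_pM2r ?exprn_even_gt0 // -expr2.
  have xy2 : x * y < x ^+ 2 by rewrite [x * y]eqx.
  have D : lambda ^+ 2 / 4 - kappa = ((x - y) / 2) ^+ 2.
    by rewrite -eqx -/y lE; field.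
  have D0 : 0 < ((x - y) / 2) ^+ 2.
    have : x - y != 0 by rewrite subr_eq0; apply/eqP => E; move: y2; rewrite E expr2 ltxx.
    by move=> h; rewrite exprn_even_gt0 //= mulf_neq0.
  rewrite D; split=> //; rewrite sqrtr_sqr lE.
  case: (ltrgt0P x) x0 => [xp _|xn _|] //.
    have yp : 0 < y by rewrite -(pmulr_rgt0 _ xp).
    have yx : y < x by nra.
    have l0 : 0 < x + y by lra.
    have d0 : 0 < (x - y) / 2 by lra.
    by rewrite (gtr0_sg l0) (gtr0_norm l0) (gtr0_norm d0); field.
  have yn : y < 0 by rewrite -(nmulr_rgt0 _ xn).
  have yx : x < y by nra.
  have l0 : x + y < 0 by lra.
  have d0 : (x - y) / 2 < 0 by lra.
  by rewrite (ltr0_sg l0) (ltr0_norm l0) (ltr0_norm d0); field.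
- move=> [D0 ->].
  set s := Num.sqrt _.
  have s0 : 0 < s by rewrite sqrtr_gt0.
  have s2 : s ^+ 2 = lambda ^+ 2 / 4 - kappa by rewrite sqr_sqrtr // ltW.
  have l0 : lambda != 0.
    by apply/eqP => l0; move: D0; rewrite l0 expr0n /= mul0r sub0r oppr_gt0 ltNge ltW.
  have sg2 : Num.sg lambda ^+ 2 = 1 by rewrite sqr_sg l0.
  have lE : lambda = Num.sg lambda * `|lambda| by rewrite -numEsg.
  have ap : 0 < `|lambda| by rewrite normr_gt0.
  move: s2; rewrite -(real_normK (num_real lambda)) => s2.
  split.
    rewrite {3}lE.
    have -> : Num.sg lambda * (`|lambda| / 2 + s) *
        (Num.sg lambda * `|lambda| - Num.sg lambda * (`|lambda| / 2 + s)) =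
      Num.sg lambda ^+ 2 * (`|lambda| ^+ 2 / 4 - s ^+ 2) by field.
    rewrite sg2 s2; ring.
  rewrite exprMn sg2 mul1r; nra.
Qed.

(** The other increments are inverses of the jump, hence of modulus below 1. *)
Lemma jump_gt1P (R : realType) (N : nat) (w : 'I_N -> R) (i : 'I_N) :
  (1 < N)%N -> N%:R - 1 < w i ^+ 2 -> (forall j, j != i -> w j * w i = 1) ->
  (forall j, 1 < `|w j| <-> j = i) /\ (forall j, `|w j| <> 1).
Proof.
move=> N1 xn xy.
have n1 : 1 <= N%:R - 1 :> R.
  by rewrite lerBrDr; have : 2%:R <= N%:R :> R; [rewrite ler_nat|lra].
have x1 : 1 < `|w i|.
  by rewrite -(@ltr_pXn2r _ 2) ?nnegrE // expr1n real_normK ?num_real //; lra.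
have y1 j : j != i -> `|w j| < 1.
  move=> ji; have := congr1 (fun z => `|z|) (xy j ji).
  rewrite normrM normr1 => E; rewrite ltNge; apply/negP => h.
  by nra.
split=> j.
  split=> [j1|->//]; apply/eqP; apply: contraT => /y1.
  by rewrite ltNge (ltW j1).
have [->|/y1 + E] := eqVneq j i; first by move=> E; move: x1; rewrite E ltxx.
by rewrite E ltxx.
Qed.

Lemma increment_linear_config (R : realType) (N : nat) (lambda : R) (i : 'I_N) :
  increment (linear_config N lambda) i = lambda / N%:R.
Proof.
rewrite /increment !mxE /= /bump /= add1n -mulrBl -mulrBr -natr1.
by rewrite addrAC subrr add0r mulr1.
Qed.

Lemma boundary_set_linear_config (R : realType) (N : nat) (lambda : R) :
  (0 < N)%N -> boundary_set N lambda (linear_config N lambda).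
Proof.
move=> N0; split; rewrite mxE /= ?mulr0 ?mul0r //.
by rewrite mulfK // pnatr_eq0 -lt0n.
Qed.

Lemma linear_config_equal_increments (R : realType) (N : nat) (lambda : R)
    (u : 'rV[R]_N.+1) : (0 < N)%N -> boundary_set N lambda u ->
  (forall i j, increment u i = increment u j) -> u = linear_config N lambda.
Proof.
move=> N0 Au ueq; apply: (boundary_set_inj Au) => [|i].
  exact: boundary_set_linear_config.
rewrite increment_linear_config -(sum_increment Au).
rewrite (eq_bigr (fun=> increment u i)) // sumr_const card_ord.
by rewrite -[_ *+ N]mulr_natr mulfK // pnatr_eq0 -lt0n.
Qed.

Lemma eps_gt0_lt1 (R : realType) (N : nat) : (1 < N)%N -> 0 < (N%:R^-1 : R) < 1.
Proof.
by move=> N1; rewrite invr_gt0 ltr0n (ltnW N1) invf_lt1 ?ltr1n // ltr0n ltnW.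
Qed.

Lemma log_eps_gt0 (R : realType) (N : nat) :
  (1 < N)%N -> 0 < `|ln (N%:R^-1 : R)|.
Proof.
by move=> N1; rewrite normr_gt0 lt_eqF // ln_lt0 // eps_gt0_lt1.
Qed.

Lemma scaled_linear_lt1 (R : realType) (N : nat) (lambda : R) (i : 'I_N) :
  (1 < N)%N -> let eps : R := N%:R^-1 in
  (`|scaled_increment eps (linear_config N lambda) i| < 1) =
  (`|lambda| < 1 / Num.sqrt (eps * `|ln eps|)).
Proof.
move=> N1 eps; have /andP[eps0 _] : 0 < eps < 1 by exact: eps_gt0_lt1.
have L0 : 0 < `|ln eps| by exact: log_eps_gt0.
have s0 : 0 < Num.sqrt (eps * `|ln eps|) by rewrite sqrtr_gt0 mulr_gt0.
have wE : scaled_increment eps (linear_config N lambda) i =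
    Num.sqrt (eps * `|ln eps|) * lambda.
  have -> : eps * `|ln eps| = eps ^+ 2 * (`|ln eps| / eps).
    by field; rewrite gt_eqF.
  rewrite sqrtrM ?sqr_ge0 // sqrtr_sqr gtr0_norm //.
  by rewrite /scaled_increment increment_linear_config -/eps; ring.
by rewrite wE normrM (gtr0_norm s0) ltr_pdivlMr // mulrC.
Qed.

Lemma linear_config_equal_scaled_increments (R : realType) (N : nat) (lambda : R) (u : 'rV[R]_N.+1) :
  (1 < N)%N -> let eps : R := N%:R^-1 in
  boundary_set N lambda u ->
  (forall i j, scaled_increment eps u i = scaled_increment eps u j) ->
  u = linear_config N lambda.
Proof.
move=> N1 eps Au weq; apply: linear_config_equal_increments => //; first exact: ltnW.
move=> i j; apply: (mulfI (_ : Num.sqrt (`|ln eps| / eps) != 0)); last exact: weq.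
have /andP[eps0 _] : 0 < eps < 1 by exact: eps_gt0_lt1.
by rewrite gt_eqF // sqrtr_gt0 divr_gt0 // log_eps_gt0.
Qed.

(** With [K = `|ln eps| / eps] the square of the scaling factor and
    [kappa = (1 - eps) / `|ln eps|] one has [K * kappa = N - 1], so that the
    condition on the scaled increments becomes [jump_equationP] for the
    unscaled jump. *)
Lemma scaled_jumpP (R : realType) (N : nat) (lambda : R) (u : 'rV[R]_N.+1)
    (i : 'I_N) :
  (1 < N)%N -> let eps : R := N%:R^-1 in let w := scaled_increment eps u in
  boundary_set N lambda u ->
  (N%:R - 1 < w i ^+ 2 /\ forall j, j != i -> w j * w i = 1) <->
  (2 * Num.sqrt ((1 - eps) / `|ln eps|) < `|lambda| /\
   has_jump_increments eps lambda i u).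
Proof.
move=> N1 eps w Au.
have /andP[eps0 eps1] : 0 < eps < 1 by exact: eps_gt0_lt1.
have L0 : 0 < `|ln eps| by exact: log_eps_gt0.
pose kappa := (1 - eps) / `|ln eps|.
have kappa0 : 0 < kappa by rewrite divr_gt0 // subr_gt0.
pose K := `|ln eps| / eps.
have K0 : 0 < K by rewrite divr_gt0.
have wM j l : w j * w l = K * (increment u j * increment u l).
  rewrite /w /scaled_increment mulrACA -expr2 sqr_sqrtr //; exact: ltW.
have nE : N%:R - 1 = K * kappa.
  have -> : N%:R = eps^-1 :> R by rewrite invrK.
  by rewrite /K /kappa; field; rewrite !gt_eqF.
have n0 : 0 < N%:R - 1 :> R by rewrite nE mulr_gt0.
set x := increment u i.
have sum_u : \sum_(j < N | j != i) increment u j = lambda - x.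
  by rewrite -(sum_increment Au) [in RHS](bigD1 i) //= -/x addrAC subrr add0r.
rewrite expr2 wM -/x nE ltr_pM2l // -expr2; split.
- move=> [xk xy].
  have x0 : x != 0.
    by apply/eqP => x0; move: xk; rewrite x0 expr0n /= ltNge ltW.
  have Kx0 : K * x != 0 by rewrite mulf_neq0 // lt0r_neq0.
  have uj j : j != i -> increment u j = (K * x)^-1.
    move=> ji; apply: (mulfI Kx0); rewrite divff //.
    by have := xy j ji; rewrite wM -/x => <-; ring.
  have lx : lambda - x = (N%:R - 1) * (K * x)^-1.
    rewrite -sum_u (eq_bigr (fun=> (K * x)^-1)); last exact: uj.
    by rewrite sum_other_const.
  have eqx : x * (lambda - x) = kappa.
    by rewrite lx nE; field; rewrite x0 lt0r_neq0.
  have [thr xE] := (jump_equationP lambda x kappa0).1 (conj eqx xk).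
  split=> //; split=> // j ji.
  by rewrite uj // -/x lx [RHS]mulrC mulKf // lt0r_neq0.
- move=> [thr [xE uj]].
  have [eqx xk] := (jump_equationP lambda x kappa0).2 (conj thr xE).
  split=> // j ji; rewrite wM uj // -/x nE -eqx.
  have : x * (lambda - x) != 0 by rewrite eqx lt0r_neq0.
  rewrite mulf_eq0 negb_or => /andP[x0 lx0].
  by field; rewrite x0 lx0 lt0r_neq0.
Qed.

Lemma jump_increments_exists (R : realType) (N : nat) (eps lambda : R)
    (i : 'I_N) : (1 < N)%N ->
  exists2 u, boundary_set N lambda u & has_jump_increments eps lambda i u.
Proof.
move=> N1; pose x := jump_size eps lambda.
pose g j := if j == i then x else (lambda - x) / (N%:R - 1).
have n0 : N%:R - 1 != 0 :> R by rewrite subr_eq0 pnatr_eq1 gtn_eqF.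
exists (of_increments g); last first.
  split=> [|j ji]; rewrite !of_incrementsK /g eqxx //.
  by rewrite (negPf ji).
have -> : lambda = \sum_j g j; last exact: boundary_set_of_increments.
rewrite (bigD1 i) //= (eq_bigr (fun=> (lambda - x) / (N%:R - 1))); last first.
  by move=> j ji; rewrite /g (negPf ji).
by rewrite sum_other_const [X in _ + X]mulrC divfK // /g eqxx addrC subrK.
Qed.

Lemma jump_increments_inj (R : realType) (N : nat) (eps lambda : R) (i : 'I_N)
    (u v : 'rV[R]_N.+1) :
  boundary_set N lambda u -> boundary_set N lambda v ->
  has_jump_increments eps lambda i u -> has_jump_increments eps lambda i v ->
  u = v.
Proof.
move=> Au Av [ui uj] [vi vj]; apply: (boundary_set_inj Au Av) => j.
have [->|ji] := eqVneq j i; first by rewrite ui vi.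
by rewrite uj // vj // ui vi.
Qed.

(** * Classification of the local minimizers *)

Theorem mainTheorem1 (R : realType) (N : nat) (hN : (3 <= N)%N) (lambda : R) :
  let eps : R := N%:R^-1 in
  let A : set 'rV[R]_N.+1 := boundary_set N lambda in
  let locmin : 'rV[R]_N.+1 -> Prop := local_minimizer A (energy eps) in
  let w : 'rV[R]_N.+1 -> 'I_N -> R := scaled_increment eps in
  let linear_threshold : R := 1 / Num.sqrt (eps * `|ln eps|) in
  let jump_threshold : R := 2 * Num.sqrt ((1 - eps) / `|ln eps|) in
  (* the complete list of local minimizers *)
  (forall u : 'rV[R]_N.+1, locmin u <->
     (`|lambda| < linear_threshold /\ u = linear_config N lambda) \/
     (jump_threshold < `|lambda| /\
      exists i : 'I_N, A u /\ has_jump_increments eps lambda i u)) /\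
  (* (a) *)
  ((forall u : 'rV[R]_N.+1,
      (A u /\ forall i j : 'I_N, w u i = w u j) <-> u = linear_config N lambda) /\
   (locmin (linear_config N lambda) <-> `|lambda| < linear_threshold) /\
   (`|lambda| < linear_threshold ->
      forall i : 'I_N, `|w (linear_config N lambda) i| < 1)) /\
  (* (b) *)
  (((exists u : 'rV[R]_N.+1, locmin u /\ exists! i : 'I_N, 1 < `|w u i|) <->
      jump_threshold < `|lambda|) /\
   (jump_threshold < `|lambda| ->
      forall i : 'I_N,
        (exists! u : 'rV[R]_N.+1,
           locmin u /\ forall j : 'I_N, 1 < `|w u j| <-> j = i) /\
        (forall u : 'rV[R]_N.+1,
           locmin u -> (forall j : 'I_N, 1 < `|w u j| <-> j = i) ->
           has_jump_increments eps lambda i u))) /\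
  (* no other behaviour of the scaled increments *)
  (forall u : 'rV[R]_N.+1, locmin u ->
     (forall i j : 'I_N, 1 < `|w u i| -> 1 < `|w u j| -> i = j) /\
     (forall i : 'I_N, `|w u i| <> 1)).
Proof.
move=> eps A locmin w linear_threshold jump_threshold.
have N1 : (1 < N)%N by apply: leq_trans hN.
have N0 : (0 < N)%N by apply: ltnW.
pose o : 'I_N := Ordinal N0.
have eps01 : 0 < eps < 1 by exact: eps_gt0_lt1.
have Alin : A (linear_config N lambda) by exact: boundary_set_linear_config.
have wlin i j : w (linear_config N lambda) i = w (linear_config N lambda) j.
  by rewrite /w /scaled_increment !increment_linear_config.
have lin_lt1 i : (`|w (linear_config N lambda) i| < 1) =
    (`|lambda| < linear_threshold) by exact: scaled_linear_lt1.
have jumpP u i : A u -> (N%:R - 1 < w u i ^+ 2 /\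
    forall j, j != i -> w u j * w u i = 1) <->
    (jump_threshold < `|lambda| /\ has_jump_increments eps lambda i u).
  by move=> Au; exact: scaled_jumpP.
have jump_gt1 u i : A u -> jump_threshold < `|lambda| ->
    has_jump_increments eps lambda i u ->
    (forall j, 1 < `|w u j| <-> j = i) /\ (forall j, `|w u j| <> 1).
  move=> Au thr ju; have [xn xy] := (jumpP u i Au).2 (conj thr ju).
  exact: jump_gt1P.
have locminP u : locmin u <->
    (`|lambda| < linear_threshold /\ u = linear_config N lambda) \/
    (jump_threshold < `|lambda| /\
     exists i : 'I_N, A u /\ has_jump_increments eps lambda i u).
  split.
    move=> /(local_minimizerP _ _ eps01)[Au /(stableP _ hN)].
    move=> [[a a1 wa]|[i xn xy]]; [left|right].
      have ulin : u = linear_config N lambda.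
        by apply: linear_config_equal_scaled_increments => // i j; rewrite !wa.
      by rewrite -(lin_lt1 o) -ulin /w wa.
    by have [thr ju] := (jumpP u i Au).1 (conj xn xy); split=> //; exists i.
  move=> [[thr ->]|[thr [i [Au ju]]]]; apply/(local_minimizerP _ _ eps01).
    split=> //; apply/(stableP _ hN); left.
    by exists (w (linear_config N lambda) o); [rewrite lin_lt1|move=> i; exact: wlin].
  split=> //; apply/(stableP _ hN); right.
  by have [xn xy] := (jumpP u i Au).2 (conj thr ju); exists i.
have jump_locmin u i : jump_threshold < `|lambda| -> A u ->
    has_jump_increments eps lambda i u -> locmin u.
  by move=> thr Au ju; apply/locminP; right; split=> //; exists i.
(* a local minimizer with an increment beyond the convexity threshold jumps
   exactly there, since the scaled increments of the linear one are below 1 *)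
have locmin_jump u i : locmin u -> 1 < `|w u i| ->
    [/\ jump_threshold < `|lambda|, A u & has_jump_increments eps lambda i u].
  move=> /locminP[[thr ->]|[thr [l [Au ju]]]] wi.
    by move: thr; rewrite -(lin_lt1 i) ltNge (ltW wi).
  by have -> : i = l by apply/(jump_gt1 u l Au thr ju).1.
split=> //; split; [split; last split|split; [split; first split|]].
- move=> u; split=> [[Au weq]|->]; last by split.
  exact: linear_config_equal_scaled_increments Au weq.
- split=> [/locminP[[]//|[thr [i [Au ju]]]]|thr]; last first.
    by apply/locminP; left.
  have [j ji] : exists j : 'I_N, j != i.
    have : (0 < #|predC1 i|)%N by rewrite cardC1 card_ord -subn1 subn_gt0.
    by case/card_gt0P => j; exists j.
  have [gt1 _] := jump_gt1 _ i Au thr ju.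
  have : 1 < `|w (linear_config N lambda) j| by rewrite (wlin j i); apply/gt1.
  by move/gt1/eqP; rewrite (negPf ji).
- by move=> thr i; rewrite lin_lt1.
- move=> [u [ulm [i [wi _]]]]; by have [] := locmin_jump u i ulm wi.
- move=> thr; have [u Au ju] := jump_increments_exists eps lambda o N1.
  have [gt1 _] := jump_gt1 u o Au thr ju.
  exists u; split; first exact: jump_locmin ju.
  by exists o; split=> [|j /gt1 ->//]; apply/gt1.
- move=> thr i; split; last first.
    by move=> u ulm wu; have [] := locmin_jump u i ulm ((wu i).2 erefl).
  have [u Au ju] := jump_increments_exists eps lambda i N1.
  exists u; split.
    by split; [exact: jump_locmin ju|exact: (jump_gt1 u i Au thr ju).1].
  move=> v [vlm wv]; have [_ Av jv] := locmin_jump v i vlm ((wv i).2 erefl).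
  exact: jump_increments_inj ju jv.
- move=> u ulm; split=> [i j wi wj|i].
    have [thr Au ju] := locmin_jump u i ulm wi.
    by apply/esym/(jump_gt1 u i Au thr ju).1.
  have /locminP[[thr ->]|[thr [l [Au ju]]]] := ulm.
    by move: thr; rewrite -(lin_lt1 i) => h E; rewrite E ltxx in h.
  exact: (jump_gt1 u l Au thr ju).2.
Qed.
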